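(* Let $N=\mathbb R^3$ with coordinates $(x,y,\theta)$, with the Lagrangian contact structure $\mathcal N=E+F$, where $E=\langle n_1\rangle$, $F=\langle n_2\rangle$, $n_1=\partial_\theta$, $n_2=\partial_x+\theta\,\partial_y$. The (infinitesimal) symmetries of $(N,\mathcal N=E+F)$ form the Lie algebra $\mathfrak{sl}(3,\mathbb R)$ generated (spanned over $\mathbb R$) by $$t_1=\partial_x,\qquad t_2=x\,\partial_y+\partial_\theta,\qquad t_3=\partial_y,$$ $$t_4=x\,\partial_x+2y\,\partial_y+\theta\,\partial_\theta,\qquad t_5=\theta\,\partial_\theta-x\,\partial_x,$$ $$t_6=\tfrac y2\,\partial_x-\tfrac{\theta^2}2\,\partial_\theta,\qquad t_7=x^2\,\partial_x+xy\,\partial_y-(\theta x-y)\,\partial_\theta,$$ $$t_8=\tfrac{xy}2\,\partial_x+\tfrac{y^2}2\,\partial_y+\tfrac\theta2(y-\theta x)\,\partial_\theta .$$ The Lie algebra $\mathfrak{sl}(3,\mathbb R)$ carries a contact grading $\mathfrak g^{-2}\oplus\mathfrak g^{-1}\oplus\mathfrak g^0\oplus\mathfrak g^1\oplus\mathfrak g^2$ as follows: $\mathfrak g^{-2}=\langle t_3\rangle$, $\mathfrak g^{-1}=\langle t_1,t_2\rangle$, $\mathfrak g^0=\langle t_4,t_5\rangle$, $\mathfrak g^1=\langle t_6,t_7\rangle$ and $\mathfrak g^2=\langle t_8\rangle$.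
   Context: A Lagrangian contact structure on a 3-dimensional contact manifold $(N,\mathcal N)$ is a decomposition of the contact distribution $\mathcal N=E\oplus F$ into two line subbundles. Its (infinitesimal) symmetries are the smooth vector fields $v$ on $N$ with $\mathcal L_vE\subset E$ and $\mathcal L_vF\subset F$, where $\mathcal L$ is the Lie derivative. A contact grading of a Lie algebra $\mathfrak g$ is a vector space decomposition $\mathfrak g=\bigoplus_{i=-2}^2\mathfrak g^i$ with $[\mathfrak g^i,\mathfrak g^j]\subset\mathfrak g^{i+j}$ (where $\mathfrak g^k=0$ for $|k|>2$), $\dim\mathfrak g^{-2}=1$, and non-degenerate bracket $\mathfrak g^{-1}\times\mathfrak g^{-1}\to\mathfrak g^{-2}$. *)

(* Defs.v *)
From mathcomp Require Import all_boot all_order all_algebra.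
From mathcomp Require Import all_classical all_reals all_analysis.

Set Implicit Arguments.
Unset Strict Implicit.
Unset Printing Implicit Defensive.

Import Order.TTheory GRing.Theory Num.Theory.
Import numFieldNormedType.Exports.

Local Open Scope classical_set_scope.
Local Open Scope ring_scope.

(* A Lie algebra is given by a subset [g] of an ambient vector space [V] and a
   map [br] on [V]. The axioms are only required on [g]: the bracket of vector
   fields below is a junk value on non-differentiable maps. *)

Definition subspace (R : realType) (V : lmodType R) (g : set V) : Prop :=
  g 0 /\ forall (a : R) (u v : V), g u -> g v -> g (a *: u + v).

Definition span_set (R : realType) (V : lmodType R) (s : seq V) : set V :=
  [set v | exists c : 'I_(size s) -> R, v = \sum_(i < size s) c i *: s`_i].

Definition has_dim (R : realType) (V : lmodType R) (g : set V) (n : nat) :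
    Prop :=
  exists s : n.-tuple V,
    (forall c : 'I_n -> R,
       \sum_(i < n) c i *: tnth s i = 0 -> forall i, c i = 0) /\
    g = span_set s.

Definition lie_algebra (R : realType) (V : lmodType R) (g : set V)
    (br : V -> V -> V) : Prop :=
  [/\ subspace g,
      forall u v, g u -> g v -> g (br u v),
      forall a u v w, g u -> g v -> g w ->
        br (a *: u + v) w = a *: br u w + br v w /\
        br w (a *: u + v) = a *: br w u + br w v,
      forall u, g u -> br u u = 0 &
      forall u v w, g u -> g v -> g w ->
        br u (br v w) + br v (br w u) + br w (br u v) = 0].

Definition lie_isomorphic (R : realType) (V W : lmodType R)
    (g : set V) (brg : V -> V -> V) (h : set W) (brh : W -> W -> W) : Prop :=
  exists phi : V -> W,
    [/\ set_bij g h phi,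
        forall a u v, g u -> g v -> phi (a *: u + v) = a *: phi u + phi v &
        forall u v, g u -> g v -> phi (brg u v) = brh (phi u) (phi v)].

Definition sl (R : realType) (n : nat) : set 'M[R]_n := [set A | \tr A = 0].

Definition mx_bracket (R : realType) (n : nat) (A B : 'M[R]_n) : 'M[R]_n :=
  A *m B - B *m A.

(* The grading is indexed by all integers, with [gr k = 0] for |k| > 2; the
   components of [v] are [u k], k = -2, ..., 2. *)
Definition contact_grading (R : realType) (V : lmodType R) (g : set V)
    (br : V -> V -> V) (gr : int -> set V) : Prop :=
  [/\ (forall k, subspace (gr k) /\ gr k `<=` g) /\
        (forall k, 2 < `|k| -> gr k = [set 0]),
      forall v, g v -> exists! u : int -> V,
        (forall k, gr k (u k)) /\ v = \sum_(i < 5) u (i%:Z - 2),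
      forall i j u v, gr i u -> gr j v -> gr (i + j) (br u v),
      has_dim (gr (- 2)) 1 &
      forall u, gr (- 1) u -> (forall v, gr (- 1) v -> br u v = 0) -> u = 0].

(* The tangent spaces of R^n are identified with R^n by the coordinates, with n
   written [n.+1], as required for the normed space structure. *)

Definition vector_field (R : realType) (n : nat) : lmodType R :=
  'rV[R]_n.+1 -> 'rV[R]_n.+1.

(* C^oo: infinitely (Frechet) differentiable, i.e. every iterated directional
   derivative of [X] is differentiable at every point. *)
Definition smooth (R : realType) (n : nat) (X : vector_field R n) : Prop :=
  forall (s : seq 'rV[R]_n.+1) (p : 'rV[R]_n.+1),
    differentiable (foldr (fun v f => 'D_v f) X s) p.

(* [X, Y]^i = sum_j X^j d_j Y^i - Y^j d_j X^i; this is the Lie derivative L_X Y. *)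
Definition lie_bracket (R : realType) (n : nat) (X Y : vector_field R n) :
    vector_field R n :=
  fun p => 'D_(X p) Y p - 'D_(Y p) X p.

Definition distribution (R : realType) (n : nat) : Type :=
  'rV[R]_n.+1 -> {vspace 'rV[R]_n.+1}.

(* Local smooth frames may be taken among the restrictions of global smooth
   vector fields, by multiplication with a bump function. *)
Definition smooth_distribution (R : realType) (n k : nat)
    (D : distribution R n) : Prop :=
  forall p : 'rV[R]_n.+1, exists X : k.-tuple (vector_field R n),
    (forall i, smooth (tnth X i)) /\
    \forall q \near p, basis_of (D q) [seq Y q | Y : vector_field R n <- X].

Definition is_section (R : realType) (n : nat) (D : distribution R n)
    (X : vector_field R n) : Prop :=
  smooth X /\ forall p, X p \in D p.

(* Contact distribution on R^3: a rank 2 distribution N whose Levi bracket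
   N x N -> TN / N, induced by the bracket of sections, is non-degenerate at
   every point. *)
Definition contact_distribution (R : realType) (N : distribution R 2) : Prop :=
  smooth_distribution 2 N /\
  forall (p : 'rV[R]_3) (X : vector_field R 2), is_section N X -> X p != 0 ->
    exists2 Y, is_section N Y & lie_bracket X Y p \notin N p.

Definition lagrangian_contact (R : realType) (N E F : distribution R 2) :
    Prop :=
  [/\ contact_distribution N, smooth_distribution 1 E,
      smooth_distribution 1 F &
      forall p, N p = (E p + F p)%VS /\ directv (E p + F p)].

(* L_v D \subset D; the smoothness of [lie_bracket v X] is automatic. *)
Definition lie_preserves (R : realType) (n : nat) (v : vector_field R n)
    (D : distribution R n) : Prop :=
  forall X, is_section D X -> forall p, lie_bracket v X p \in D p.

Definition symmetries (R : realType) (E F : distribution R 2) :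
    set (vector_field R 2) :=
  [set v | [/\ smooth v, lie_preserves v E & lie_preserves v F]].

Section FlatModel.
Context {R : realType}.
Implicit Type p : 'rV[R]_3.

Definition cx p : R := p 0 0.
Definition cy p : R := p 0 1.
Definition ctheta p : R := p 0 2.

Definition d_x : 'rV[R]_3 := delta_mx 0 0.
Definition d_y : 'rV[R]_3 := delta_mx 0 1.
Definition d_theta : 'rV[R]_3 := delta_mx 0 2.

Definition n1 : vector_field R 2 := fun p => d_theta.
Definition n2 : vector_field R 2 := fun p => d_x + ctheta p *: d_y.

Definition distE : distribution R 2 := fun p => <[n1 p]>%VS.
Definition distF : distribution R 2 := fun p => <[n2 p]>%VS.
Definition distN : distribution R 2 := fun p => (distE p + distF p)%VS.

Definition t1 : vector_field R 2 := fun p => d_x.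
Definition t2 : vector_field R 2 := fun p => cx p *: d_y + d_theta.
Definition t3 : vector_field R 2 := fun p => d_y.
Definition t4 : vector_field R 2 := fun p =>
  cx p *: d_x + (2 * cy p) *: d_y + ctheta p *: d_theta.
Definition t5 : vector_field R 2 := fun p =>
  ctheta p *: d_theta - cx p *: d_x.
Definition t6 : vector_field R 2 := fun p =>
  (cy p / 2) *: d_x - (ctheta p ^+ 2 / 2) *: d_theta.
Definition t7 : vector_field R 2 := fun p =>
  (cx p ^+ 2) *: d_x + (cx p * cy p) *: d_y
  - (ctheta p * cx p - cy p) *: d_theta.
Definition t8 : vector_field R 2 := fun p =>
  (cx p * cy p / 2) *: d_x + (cy p ^+ 2 / 2) *: d_y
  + (ctheta p / 2 * (cy p - ctheta p * cx p)) *: d_theta.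

Definition flat_grading (k : int) : set (vector_field R 2) :=
  span_set (if k == - 2 then [:: t3]
            else if k == - 1 then [:: t1; t2]
            else if k == 0 then [:: t4; t5]
            else if k == 1 then [:: t6; t7]
            else if k == 2 then [:: t8]
            else [::]).

End FlatModel.

(* Main.v *)
From HB Require Import structures.
Require Import Defs.
From mathcomp Require Import all_boot all_order all_algebra.
From mathcomp Require Import all_classical all_reals all_analysis.
From mathcomp Require Import ring lra zify.

Set Implicit Arguments.
Unset Strict Implicit.
Unset Printing Implicit Defensive.

Import Order.TTheory GRing.Theory Num.Theory.
Import numFieldNormedType.Exports.

Local Open Scope classical_set_scope.
Local Open Scope ring_scope.

(** Write v = a d_x + b d_y + c d_theta. Preserving E forces a and b not to
    depend on theta. Preserving F forces c = n2 b - theta n2 a and n2 c = 0: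
    along the integral curves of n2, which project to the straight lines of
    slope theta in the (x, y)-plane, b - theta a is affine with slope c. So
    (a, b) is a planar field whose flow carries lines to lines to first order,
    that is, a projective field, and c is its prolongation to the space of
    directions.

    The classification is made algebraic, without second derivatives
    ([projective_displacement]). As c is a polynomial of degree 2 in theta, the
    affine law reads t (b(q) - b(p)) - s (a(q) - a(p)) = Q_p(t, s) for
    (t, s) = q - p, where Q_p is a quadratic form depending on p; it extends
    from t <> 0 to t = 0 by continuity. Subtracting the law at p = (0, 0) from
    the laws at (0, 1) and (1, 0) exhibits a and b as polynomials of degree 2,
    and the cubic terms of the law at (0, 0) leave exactly 8 free coefficients.

    Projective fields come from matrices: [proj_field A] is the field on the
    chart [1 : x : y] of the action of A on row vectors, prolonged to R^3. It
    is linear in A, turns commutators into Lie brackets ([proj_field_bracket])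
    and is injective on traceless matrices, so the symmetries are a copy of
    sl(3) and the Lie algebra axioms are those of matrices. The fields t_i are
    images of a basis of sl(3), and the part of degree k is the image of the
    traceless matrices supported on the diagonal i - j = k, so that the grading
    axioms are facts on products of matrix entries.

    The contact condition is a formula for the Levi form: for sections X, Y of
    N, the form dy - theta dx takes the value X_theta Y_x - Y_theta X_x on
    [X, Y] ([levi_form]). *)

(** * Coordinates of vectors and matrices of size 3 *)

Section Coordinates.
Context {R : realType}.

Lemma ord3P (P : 'I_3 -> Prop) : P 0 -> P 1 -> P 2 -> forall i, P i.
Proof.
move=> P0 P1 P2 [[|[|[|//]]] i3].
- by rewrite (_ : Ordinal i3 = 0) //; exact: val_inj.
- by rewrite (_ : Ordinal i3 = 1) //; exact: val_inj.
- by rewrite (_ : Ordinal i3 = 2) //; exact: val_inj.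
Qed.

Lemma sum_ord3 (V : nmodType) (F : 'I_3 -> V) :
  \sum_(i < 3) F i = F 0 + F 1 + F 2.
Proof.
rewrite !big_ord_recl big_ord0 addr0 addrA.
by congr (_ + F _ + F _); exact: val_inj.
Qed.

Lemma rV3P (u v : 'rV[R]_3) :
  u 0 0 = v 0 0 -> u 0 1 = v 0 1 -> u 0 2 = v 0 2 -> u = v.
Proof. by move=> *; apply/rowP; exact: ord3P. Qed.

Definition vec3 (a b c : R) : 'rV[R]_3 :=
  a *: d_x + b *: d_y + c *: d_theta.

Lemma vec3E a b c :
  (vec3 a b c 0 0 = a) * (vec3 a b c 0 1 = b) * (vec3 a b c 0 2 = c).
Proof.
by split; [split|]; rewrite !mxE /= ?mulr1 ?mulr0 ?addr0 ?add0r.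
Qed.

Lemma row_linE (a : R) (u v : 'rV[R]_3) i :
  (a *: u + v) 0 i = a * u 0 i + v 0 i.
Proof. by rewrite !mxE. Qed.

Lemma row_scaleE (a : R) (u : 'rV[R]_3) i : (a *: u) 0 i = a * u 0 i.
Proof. by rewrite mxE. Qed.

Lemma row_addE (u v : 'rV[R]_3) i : (u + v) 0 i = u 0 i + v 0 i.
Proof. by rewrite mxE. Qed.

Lemma row_subE (u v : 'rV[R]_3) i : (u - v) 0 i = u 0 i - v 0 i.
Proof. by rewrite !mxE. Qed.

Lemma vec3_coord (p : 'rV[R]_3) : p = vec3 (p 0 0) (p 0 1) (p 0 2).
Proof. by apply: rV3P; rewrite !vec3E. Qed.

Lemma vec3D x y z x' y' z' (t : R) :
  vec3 x y z + t *: vec3 x' y' z' = vec3 (x + t * x') (y + t * y') (z + t * z').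
Proof. by apply: rV3P; rewrite row_addE row_scaleE !vec3E. Qed.

Lemma d_xE : d_x = vec3 1 0 0.
Proof. by rewrite /vec3 !scale0r !addr0 scale1r. Qed.

Lemma d_thetaE : d_theta = vec3 0 0 1.
Proof. by rewrite /vec3 !scale0r !add0r scale1r. Qed.

End Coordinates.

Section Matrix3.
Context {R : realType}.
Implicit Types A B : 'M[R]_3.

Definition mx3 (a b c d e f g h k : R) : 'M[R]_3 :=
  \matrix_(i < 3, j < 3)
    nth 0 (nth [::] [:: [:: a; b; c]; [:: d; e; f]; [:: g; h; k]] i) j.

Lemma mx3E a b c d e f g h k : let M := mx3 a b c d e f g h k in
  ((M 0 0 = a) * (M 0 1 = b) * (M 0 2 = c) *
   (M 1 0 = d) * (M 1 1 = e) * (M 1 2 = f) *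
   (M 2 0 = g) * (M 2 1 = h) * (M 2 2 = k))%type.
Proof. by do !split; rewrite mxE. Qed.

Lemma tr3E A : \tr A = A 0 0 + A 1 1 + A 2 2.
Proof. exact: sum_ord3. Qed.

Lemma mx3P A B :
  A 0 0 = B 0 0 -> A 0 1 = B 0 1 -> A 0 2 = B 0 2 ->
  A 1 0 = B 1 0 -> A 1 1 = B 1 1 -> A 1 2 = B 1 2 ->
  A 2 0 = B 2 0 -> A 2 1 = B 2 1 -> A 2 2 = B 2 2 -> A = B.
Proof. by move=> *; apply/matrixP; do 2!apply: ord3P. Qed.

End Matrix3.

(** * Polynomial vector fields and derivatives *)

Section Differentiation.
Context {R : realType} {n : nat}.
Implicit Types (f g : 'rV[R]_n.+1 -> R) (X : vector_field R n).
Implicit Types p w : 'rV[R]_n.+1.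

Lemma is_derive_const p w (k : R) : is_derive p w (fun=> k) 0.
Proof. exact: is_derive_cst. Qed.

Lemma is_derive_add f g p w (df dg : R) : is_derive p w f df ->
  is_derive p w g dg -> is_derive p w (fun q => f q + g q) (df + dg).
Proof. exact: is_deriveD. Qed.

Lemma is_derive_opp f p w (df : R) : is_derive p w f df ->
  is_derive p w (fun q => - f q) (- df).
Proof. exact: is_deriveN. Qed.

Lemma is_derive_mul f g p w (df dg : R) : is_derive p w f df ->
  is_derive p w g dg ->
  is_derive p w (fun q => f q * g q) (f p * dg + g p * df).
Proof. exact: is_deriveM. Qed.

Lemma is_derive_val f p w (df d : R) :
  is_derive p w f df -> df = d -> 'D_w f p = d.
Proof. by case=> _ -> ->. Qed.

Lemma coord_differentiable X p i :
  differentiable X p -> differentiable (fun q => X q 0 i) p.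
Proof.
move=> dX; apply: (@differentiable_comp _ _ _ _ X (fun v => v 0 i)) => //.
exact: differentiable_coord.
Qed.

Lemma derive_coord X p w i :
  differentiable X p -> ('D_w X p) 0 i = 'D_w (fun q => X q 0 i) p.
Proof. by move=> dX; rewrite derive_mx ?mxE//; exact: diff_derivable. Qed.

Lemma is_derive_coord p w i :
  is_derive p w (fun q : 'rV[R]_n.+1 => q 0 i) (w 0 i).
Proof.
have di := @differentiable_coord _ _ _ p 0 i.
apply: DeriveDef; first exact: diff_derivable.
by rewrite -(@derive_coord id) ?derive_id.
Qed.

Lemma field_differentiable X p :
  (forall i, differentiable (fun q => X q 0 i) p) -> differentiable X p.
Proof.
move=> dX.
rewrite (_ : X = \sum_(i < n.+1) (fun q => X q 0 i *: delta_mx 0 i)).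
  by apply: differentiable_sum => i; exact: differentiableZl.
by apply/funext => q; rewrite fct_sumE [LHS]row_sum_delta.
Qed.

Lemma smooth_differentiable X : smooth X -> forall p, differentiable X p.
Proof. by move=> sX p; exact: (sX [::]). Qed.

(** Functions of a point given by a polynomial expression in its coordinates,
    as an inductive predicate so that stability under directional derivatives,
    hence smoothness, is proved by induction on the expression. *)
Inductive polyfun : ('rV[R]_n.+1 -> R) -> Prop :=
| polyfun_const k : polyfun (fun=> k)
| polyfun_coord i : polyfun (fun q => q 0 i)
| polyfun_add f g : polyfun f -> polyfun g -> polyfun (fun q => f q + g q)
| polyfun_mul f g : polyfun f -> polyfun g -> polyfun (fun q => f q * g q).

Lemma polyfun_opp f : polyfun f -> polyfun (fun q => - f q).
Proof.
move=> pf; rewrite (_ : (fun q => - f q) = (fun q => -1 * f q)).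
  by apply: polyfun_mul => //; exact: polyfun_const.
by apply/funext => q; rewrite mulN1r.
Qed.

Lemma polyfun_differentiable f p : polyfun f -> differentiable f p.
Proof.
elim=> [k|i|g h _ dg _ dh|g h _ dg _ dh].
- exact: differentiable_cst.
- exact: differentiable_coord.
- exact: differentiableD.
- exact: differentiableM.
Qed.

Lemma polyfun_is_derive f p w : polyfun f -> is_derive p w f ('D_w f p).
Proof.
by move=> pf; apply/derivableP/diff_derivable/polyfun_differentiable.
Qed.

Lemma polyfun_derive f w : polyfun f -> polyfun ('D_w f).
Proof.
elim=> [k|i|g h pg dg ph dh|g h pg dg ph dh].
- rewrite (_ : 'D_w _ = fun=> 0); first exact: polyfun_const.
  by apply/funext => q; rewrite derive_cst.
- rewrite (_ : 'D_w _ = fun=> w 0 i); first exact: polyfun_const.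
  by apply/funext => q; have [_ ->] := is_derive_coord q w i.
- rewrite (_ : 'D_w _ = fun q => 'D_w g q + 'D_w h q); first exact: polyfun_add.
  apply/funext => q.
  have [dg' dh'] := (polyfun_is_derive q w pg, polyfun_is_derive q w ph).
  by have [_ ->] := is_derive_add dg' dh'.
- rewrite (_ : 'D_w _ = fun q => g q * 'D_w h q + h q * 'D_w g q).
    by do 2?apply: polyfun_add; apply: polyfun_mul.
  apply/funext => q.
  have [dg' dh'] := (polyfun_is_derive q w pg, polyfun_is_derive q w ph).
  by have [_ ->] := is_derive_mul dg' dh'.
Qed.

Lemma polyfield_differentiable X p :
  (forall i, polyfun (fun q => X q 0 i)) -> differentiable X p.
Proof.
by move=> pX; apply: field_differentiable => i; exact: polyfun_differentiable.
Qed.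

Lemma polyfield_smooth X : (forall i, polyfun (fun q => X q 0 i)) -> smooth X.
Proof.
move=> pX s p; apply: polyfield_differentiable.
elim: s => [|v s IHs] //=; move: IHs; set Y := foldr _ _ _ => pY i.
rewrite (_ : (fun q => _) = 'D_v (fun q => Y q 0 i)).
  exact: polyfun_derive.
by apply/funext => q; rewrite derive_coord//; exact: polyfield_differentiable.
Qed.

End Differentiation.

Ltac prove_polyfun := repeat (first [exact: polyfun_const | exact: polyfun_coord
  | apply: polyfun_add | apply: polyfun_opp | apply: polyfun_mul]).

(** * Projective vector fields of the plane, prolonged to R^3 *)

Section ProjectiveFields.
Context {R : realType}.
Implicit Types (A B : 'M[R]_3) (p w : 'rV[R]_3) (x y th : R).

(** With l = (1, x, y) A, the point [1 : x : y] moves with velocity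
    (l_1 - x l_0, l_2 - y l_0) in the chart (x, y). *)
Definition proj_x A x y : R :=
  A 0 1 + x * A 1 1 + y * A 2 1 - x * (A 0 0 + x * A 1 0 + y * A 2 0).

Definition proj_y A x y : R :=
  A 0 2 + x * A 1 2 + y * A 2 2 - y * (A 0 0 + x * A 1 0 + y * A 2 0).

(** A planar field (a, b) moves the slope theta of a line element at the rate
    b_x + theta (b_y - a_x) - theta^2 a_y; here a = [proj_x A] and
    b = [proj_y A]. *)
Definition proj_theta A x y th : R :=
  A 1 2 - y * A 1 0 + th * (A 2 2 - A 1 1 - y * A 2 0 + x * A 1 0)
  - th * th * (A 2 1 - x * A 2 0).

Definition proj_field A : vector_field R 2 := fun p =>
  vec3 (proj_x A (p 0 0) (p 0 1)) (proj_y A (p 0 0) (p 0 1))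
       (proj_theta A (p 0 0) (p 0 1) (p 0 2)).

Lemma proj_field_polyfun A i : polyfun (fun q => proj_field A q 0 i).
Proof.
elim/ord3P: i; under eq_fun do rewrite vec3E; prove_polyfun.
Qed.

Lemma proj_field_smooth A : smooth (proj_field A).
Proof. exact/polyfield_smooth/proj_field_polyfun. Qed.

Lemma proj_field_differentiable A p : differentiable (proj_field A) p.
Proof. exact/smooth_differentiable/proj_field_smooth. Qed.

Lemma derive_proj_field A p w :
  let x := p 0 0 in let y := p 0 1 in let th := p 0 2 in
  let dx := w 0 0 in let dy := w 0 1 in let dth := w 0 2 in
  'D_w (proj_field A) p = vec3
    (dx * A 1 1 + dy * A 2 1 - dx * (A 0 0 + x * A 1 0 + y * A 2 0)
      - x * (dx * A 1 0 + dy * A 2 0))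
    (dx * A 1 2 + dy * A 2 2 - dy * (A 0 0 + x * A 1 0 + y * A 2 0)
      - y * (dx * A 1 0 + dy * A 2 0))
    (- dy * A 1 0 + dth * (A 2 2 - A 1 1 - y * A 2 0 + x * A 1 0)
      + th * (dx * A 1 0 - dy * A 2 0)
      - 2 * th * dth * (A 2 1 - x * A 2 0) + th * th * dx * A 2 0).
Proof.
move=> x y th dx dy dth; have dA := @proj_field_differentiable A p.
by apply: rV3P; rewrite derive_coord// vec3E;
  under eq_fun do rewrite vec3E;
  (apply: is_derive_val; [by repeat first
    [exact: is_derive_const | exact: is_derive_coord | apply: is_derive_add
    | apply: is_derive_opp | apply: is_derive_mul]
  | rewrite /x /y /th /dx /dy /dth; ring]).
Qed.

Lemma proj_field_linear (a : R) A B :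
  proj_field (a *: A + B) = a *: proj_field A + proj_field B.
Proof.
apply/funext => p; rewrite -[RHS]/(a *: proj_field A p + proj_field B p).
by apply: rV3P; rewrite row_linE !vec3E /proj_x /proj_y /proj_theta !mxE; ring.
Qed.

(** For the linear fields Z |-> Z A on row vectors the Lie bracket is
    Z |-> Z A B - Z B A; a left action would reverse the sign. *)
Lemma proj_field_bracket A B :
  lie_bracket (proj_field A) (proj_field B) = proj_field (mx_bracket A B).
Proof.
apply/funext => p; rewrite /lie_bracket !derive_proj_field /=.
have brE i j : mx_bracket A B i j =
    A i 0 * B 0 j + A i 1 * B 1 j + A i 2 * B 2 j
    - (B i 0 * A 0 j + B i 1 * A 1 j + B i 2 * A 2 j).
  by rewrite !mxE !sum_ord3.
apply: rV3P; rewrite row_subE !vec3E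
  /proj_x /proj_y /proj_theta ?brE; ring.
Qed.

(** The kernel of [proj_field] consists of the scalar matrices. The eight
    values below determine a matrix up to a scalar one. *)
Lemma proj_field_inj A B : sl A -> sl B -> proj_field A = proj_field B -> A = B.
Proof.
rewrite /sl /= !tr3E => trA trB AB.
have ABx x y : proj_x A x y = proj_x B x y.
  by have := congr1 (fun v : 'rV_3 => v 0 0) (congr1 (@^~ (vec3 x y 0)) AB);
    rewrite /proj_field !vec3E.
have ABy x y : proj_y A x y = proj_y B x y.
  by have := congr1 (fun v : 'rV_3 => v 0 1) (congr1 (@^~ (vec3 x y 0)) AB);
    rewrite /proj_field !vec3E.
have := (ABx 0 0, ABx 1 0, ABx (-1) 0, ABx 0 1,
  (ABy 0 0, ABy 0 1, ABy 0 (-1), ABy 1 0)).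
rewrite /proj_x /proj_y => -[[[[]]]] h1 h2 h3 h4 [[[]]] k1 k2 k3 k4.
apply: mx3P; lra.
Qed.

End ProjectiveFields.

(** * The flat Lagrangian contact structure *)

(** A section of the line field spanned by e is f e with f smooth, and
    [v, f e] = (v f) e + f [v, e]. The normalization of e makes f a coordinate
    of the section. *)
Lemma lie_preserves_line (R : realType) (n : nat) (v e : vector_field R n) i :
  (forall p, differentiable v p) -> (forall p, differentiable e p) ->
  (forall p, e p 0 i = 1) -> (forall p, lie_bracket v e p \in <[e p]>%VS) ->
  lie_preserves v (fun p => <[e p]>%VS).
Proof.
move=> dv de e1 ve X [/smooth_differentiable dX Xe] p.
have XE q : X q = X q 0 i *: e q.
  by have /vlineP[k ->] := Xe q; rewrite !mxE e1 mulr1.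
have -> : lie_bracket v X p =
    'D_(v p) (fun q => X q 0 i) p *: e p + X p 0 i *: lie_bracket v e p.
  rewrite /lie_bracket [in 'D_(X p) v p]XE (deriveE _ (dv p)) linearZ/=.
  rewrite -(deriveE _ (dv p)) scalerBr addrA; congr (_ - _).
  apply/rowP => j; rewrite derive_coord//.
  rewrite (_ : (fun q => X q 0 j) = (fun q => X q 0 i * e q 0 j)); last first.
    by apply/funext => q; rewrite {1}XE mxE.
  have dXi : derivable (fun q => X q 0 i) p (v p).
    exact/diff_derivable/coord_differentiable.
  have dej : derivable (fun q => e q 0 j) p (v p).
    exact/diff_derivable/coord_differentiable.
  have [_ ->] := is_derive_mul (derivableP dXi) (derivableP dej).
  by rewrite !mxE derive_coord//; ring.
by apply: memvD; apply: memvZ => //; exact: memv_line.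
Qed.

Section FlatStructure.
Context {R : realType}.
Implicit Types (p w : 'rV[R]_3) (X Y : vector_field R 2).

Lemma n1E p : n1 p = vec3 0 0 1.
Proof. exact: d_thetaE. Qed.

Lemma n2E p : n2 p = vec3 1 (p 0 2) 0.
Proof. by rewrite /vec3 scale0r addr0 scale1r. Qed.

Lemma n1_smooth : smooth (@n1 R).
Proof. by apply: polyfield_smooth => i; exact: polyfun_const. Qed.

Lemma n2_smooth : smooth (@n2 R).
Proof.
apply: polyfield_smooth; apply: ord3P;
  under eq_fun do rewrite n2E vec3E; prove_polyfun.
Qed.

Lemma derive_n1 p w : 'D_w n1 p = 0.
Proof. exact: derive_cst. Qed.

Lemma derive_n2 p w : 'D_w n2 p = vec3 0 (w 0 2) 0.
Proof.
have d2 := smooth_differentiable n2_smooth p.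
by apply: rV3P; rewrite derive_coord// vec3E;
  under eq_fun do rewrite n2E vec3E; rewrite ?derive_cst//;
  apply: is_derive_val (is_derive_coord _ _ _) _.
Qed.

Lemma mem_distE p w : (w \in distE p) = (w 0 0 == 0) && (w 0 1 == 0).
Proof.
apply/vlineP/andP => [[k ->]|[/eqP w0 /eqP w1]].
  by rewrite n1E !row_scaleE !vec3E mulr0.
exists (w 0 2); rewrite n1E.
by apply: rV3P; rewrite row_scaleE vec3E ?w0 ?w1; ring.
Qed.

Lemma mem_distF p w :
  (w \in distF p) = (w 0 1 == p 0 2 * w 0 0) && (w 0 2 == 0).
Proof.
apply/vlineP/andP => [[k ->]|[/eqP w1 /eqP w2]].
  by rewrite n2E !row_scaleE !vec3E mulr0 mulr1 mulrC !eqxx.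
exists (w 0 0); rewrite n2E.
by apply: rV3P; rewrite row_scaleE vec3E ?w1 ?w2; ring.
Qed.

Lemma mem_distN p w : (w \in distN p) = (w 0 1 == p 0 2 * w 0 0).
Proof.
apply/memv_addP/eqP => [[u + [v + ->]]|w1].
  rewrite mem_distE mem_distF => /andP[/eqP u0 /eqP u1] /andP[/eqP v1 _].
  by rewrite !row_addE u0 u1 v1 !add0r.
exists (vec3 0 0 (w 0 2)); first by rewrite mem_distE !vec3E !eqxx.
exists (vec3 (w 0 0) (w 0 1) 0); first by rewrite mem_distF !vec3E w1 !eqxx.
by apply: rV3P; rewrite row_addE !vec3E ?add0r ?addr0.
Qed.

Lemma distEF_capv p : (distE p :&: distF p)%VS = 0%VS.
Proof.
apply/eqP; rewrite -subv0; apply/subvP => w.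
rewrite memv_cap mem_distE mem_distF.
move=> /andP[/andP[/eqP w0 /eqP w1] /andP[_ /eqP w2]].
by rewrite memv0; apply/eqP/rV3P; rewrite mxE.
Qed.

Lemma n1_neq0 p : n1 p != 0.
Proof.
apply/eqP => /(congr1 (fun v : 'rV_3 => v 0 2)); rewrite n1E vec3E mxE.
by apply/eqP; exact: oner_neq0.
Qed.

Lemma n2_neq0 p : n2 p != 0.
Proof.
apply/eqP => /(congr1 (fun v : 'rV_3 => v 0 0)); rewrite n2E vec3E mxE.
by apply/eqP; exact: oner_neq0.
Qed.

Lemma distE_smooth : smooth_distribution 1 (@distE R).
Proof.
move=> p; exists [tuple n1]; split=> [i|].
  by rewrite (tnth_nth n1) [i]ord1; exact: n1_smooth.
by near=> q; rewrite /basis_of /= span_seq1 eqxx seq1_free n1_neq0.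
Unshelve. all: by end_near. Qed.

Lemma distF_smooth : smooth_distribution 1 (@distF R).
Proof.
move=> p; exists [tuple n2]; split=> [i|].
  by rewrite (tnth_nth n2) [i]ord1; exact: n2_smooth.
by near=> q; rewrite /basis_of /= span_seq1 eqxx seq1_free n2_neq0.
Unshelve. all: by end_near. Qed.

Lemma distN_smooth : smooth_distribution 2 (@distN R).
Proof.
move=> p; exists [tuple n1; n2]; split=> [[[|[|//]] i2]|].
- exact: n1_smooth.
- exact: n2_smooth.
near=> q; rewrite /basis_of /= span_cons span_seq1 eqxx free_cons seq1_free.
rewrite n2_neq0 andbT span_seq1; apply/negP => n12.
have : n1 q \in (distE q :&: distF q)%VS by rewrite memv_cap memv_line.
by rewrite distEF_capv memv0 (negPf (n1_neq0 q)).
Unshelve. all: by end_near. Qed.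

(** Derivative of the equation X_y = theta X_x of the sections of N. *)
Lemma section_distN_derive X p w : is_section distN X ->
  ('D_w X p) 0 1 = p 0 2 * ('D_w X p) 0 0 + X p 0 0 * w 0 2.
Proof.
move=> [/smooth_differentiable dX XN]; rewrite !derive_coord//.
rewrite (_ : (fun q => X q 0 1) = (fun q => q 0 2 * X q 0 0)); last first.
  by apply/funext => q; have := XN q; rewrite mem_distN => /eqP.
apply: is_derive_val (is_derive_mul (is_derive_coord _ _ _) _) _ => //.
exact/derivableP/diff_derivable/coord_differentiable.
Qed.

(** The two sides of the equation differ by the value of dy - theta dx on
    [X, Y], which [section_distN_derive] computes from X and Y at p alone. *)
Lemma levi_form X Y p : is_section distN X -> is_section distN Y ->
  (lie_bracket X Y p \in distN p) = (X p 0 2 * Y p 0 0 == Y p 0 2 * X p 0 0).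
Proof.
move=> XN YN; rewrite mem_distN !row_subE !section_distN_derive//.
by apply/eqP/eqP => h; lra.
Qed.

Lemma n1_section : is_section (@distN R) n1.
Proof.
by split=> [|p]; [exact: n1_smooth | rewrite mem_distN n1E !vec3E mulr0].
Qed.

Lemma n2_section : is_section (@distN R) n2.
Proof.
by split=> [|p]; [exact: n2_smooth | rewrite mem_distN n2E !vec3E mulr1].
Qed.

(** By [levi_form], n2 detects the component X_theta and n1 detects X_x, and
    these determine X in N. *)
Lemma distN_contact : contact_distribution (@distN R).
Proof.
split=> [|p X XN Xp0]; first exact: distN_smooth.
have [X2|X2] := eqVneq (X p 0 2) 0; last first.
  exists n2; first exact: n2_section.
  by rewrite (levi_form _ XN n2_section) n2E !vec3E mulr1 mul0r.
exists n1; first exact: n1_section.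
rewrite (levi_form _ XN n1_section) n1E !vec3E mulr0 mul1r eq_sym.
apply: contra Xp0 => /eqP X0.
have := (XN.2 p); rewrite mem_distN X0 mulr0 => /eqP X1.
by apply/eqP/rV3P; rewrite mxE.
Qed.

Lemma flat_lagrangian_contact : lagrangian_contact (@distN R) distE distF.
Proof.
split=> [||| p].
- exact: distN_contact.
- exact: distE_smooth.
- exact: distF_smooth.
- by split=> //; apply/directv_addP; exact: distEF_capv.
Qed.

Lemma proj_field_symmetry A : symmetries distE distF (@proj_field R A).
Proof.
have dA := @proj_field_differentiable R A.
split; first exact: proj_field_smooth.
- apply: (@lie_preserves_line _ _ _ n1 2) => // p.
  + by rewrite n1E vec3E.
  + rewrite -[<[_]>%VS]/(distE p) mem_distE /lie_bracket derive_n1.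
    rewrite derive_proj_field !row_subE !vec3E n1E !vec3E !mxE.
    by apply/andP; split; apply/eqP; ring.
- apply: (@lie_preserves_line _ _ _ n2 0) => // [p|p|p].
  + exact/smooth_differentiable/n2_smooth.
  + by rewrite n2E vec3E.
  + rewrite -[<[_]>%VS]/(distF p) mem_distF /lie_bracket derive_n2.
    rewrite derive_proj_field !row_subE !vec3E n2E !vec3E /proj_theta.
    by apply/andP; split; apply/eqP; ring.
Qed.

End FlatStructure.

(** * Every symmetry is projective *)

Section Lines.
Context {R : realType} {n : nat}.
Implicit Types (f : 'rV[R]_n.+1 -> R) (p q w : 'rV[R]_n.+1).

Lemma is_derive_line f p w (t : R) : differentiable f (p + t *: w) ->
  is_derive t 1 (fun s : R => f (p + s *: w)) ('D_w f (p + t *: w)).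
Proof.
move=> df; have dw : derivable f (p + t *: w) w by exact: diff_derivable.
have lineE :
    (fun h : R => h^-1 *: (((fun s : R => f (p + s *: w)) \o shift t) (h *: 1)
      - f (p + t *: w))) =
    (fun h : R =>
      h^-1 *: ((f \o shift (p + t *: w)) (h *: w) - f (p + t *: w))).
  apply/funext => h /=; congr (_ *: (f _ - _)).
  by rewrite [h *: 1]mulr1 scalerDl addrCA.
by split; rewrite /derivable /derive lineE.
Qed.

Lemma affine_on_line f p w (k : R) : (forall q, differentiable f q) ->
  (forall t : R, 'D_w f (p + t *: w) = k) ->
  forall t : R, f (p + t *: w) = f p + t * k.
Proof.
move=> df dfk t.
have dg (s : R) : is_derive s 1 (fun s => f (p + s *: w) + - (s * k)) 0.
  have dl := is_derive_line (df (p + s *: w)); rewrite dfk in dl.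
  have ds := is_deriveN (is_deriveM (is_derive_id s 1) (is_derive_cst k s 1)).
  apply: (@is_derive_eq _ _ _ _ _ _ _ _ (is_deriveD dl ds)).
  by rewrite scaler0 add0r [k *: 1]mulr1 subrr.
have := is_derive_0_is_cst t 0 dg.
by rewrite scale0r addr0 mul0r oppr0 addr0 => <-; rewrite subrK.
Qed.

Lemma derive_translation_invariant f p w v :
  (forall q, f (q + v) = f q) -> 'D_w f (p + v) = 'D_w f p.
Proof.
move=> fv; rewrite /derive.
set g := (X in lim (X @ _) = _); set k := (X in _ = lim (X @ _)).
suff -> : g = k by [].
by apply/funext => h; rewrite /g /k /= addrA !fv.
Qed.

End Lines.

Lemma continuous_eq0 (R : realType) (u : R -> R) (x : R) :
  {for x, continuous u} -> (forall t, t != x -> u t = 0) -> u x = 0.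
Proof.
move=> cu u0; have ux : u t @[t --> x^'] --> u x by exact: cvg_within_filter.
have u0' : u t @[t --> x^'] --> (0 : R).
  have c0 : (fun=> (0 : R)) t @[t --> x^'] --> (0 : R) by exact: cvg_cst.
  apply: cvg_trans c0; apply: near_eq_cvg.
  by near=> t; rewrite u0//; near: t; exact: nbhs_dnbhs_neq.
by rewrite -(cvg_lim _ ux)// (cvg_lim _ u0').
Unshelve. all: by end_near. Qed.

Lemma displacement_continuous (R : realType) (f g : R -> R)
    (b a s k l m x : R) :
  {for x, continuous f} -> {for x, continuous g} ->
  {for x, continuous (fun t : R => t * (f t - b) - s * (g t - a)
    - (t ^+ 2 * k + t * s * l + m))}.
Proof.
move=> cf cg.
have cst (c : R) : {for x, continuous (fun _ : R => c)} by exact: cvg_cst.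
have cid : {for x, continuous (fun t : R => t)} by exact: cvg_id.
apply: (@continuousB _ _ _ (fun t : R => t * (f t - b) - s * (g t - a))).
  apply: (@continuousB _ _ _ (fun t : R => t * (f t - b))
    (fun t : R => s * (g t - a)));
    apply: continuousM => //; exact: continuousB.
apply: continuousD => //.
apply: (@continuousD _ _ _ (fun t : R => t ^+ 2 * k) (fun t => t * s * l)).
  by apply: continuousM => //; exact: exprn_continuous.
by apply: continuousM => //; exact: continuousM.
Qed.

Section PlanarAlgebra.
Context {R : realType}.

(** The hypothesis says that a cubic polynomial in (t, s) is zero; its values
    at the twelve points below force the cubic terms to vanish. *)
Lemma cubic_coefs (b0 b1 b2 b3 b4 b5 a0 a1 a2 a3 a4 a5 p q c d e : R) :
  (forall t s : R,
     t * (b0 + b1 * t + b2 * s + b3 * t ^+ 2 + b4 * (t * s) + b5 * s ^+ 2)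
     - s * (a0 + a1 * t + a2 * s + a3 * t ^+ 2 + a4 * (t * s) + a5 * s ^+ 2)
     = t * p - s * q + (c * t ^+ 2 + d * (t * s) + e * s ^+ 2)) ->
  [/\ b3 = 0, b4 = a3, b5 = a4 & a5 = 0].
Proof.
move=> H.
have := (H 1 0, H (-1) 0, H 2 0, H 0 1, H 0 (-1), H 0 2).
have := (H 1 1, H 1 (-1), H (-1) 1, H (-1) (-1), H 2 1, H 1 2).
move=> [[[[[]]]]] h1 h2 h3 h4 h5 h6 [[[[[]]]]] k1 k2 k3 k4 k5 k6.
by split; lra.
Qed.

(** Discrete form of the statement that a planar field preserving lines is
    projective: on the line joining (x, y) to (x + t, y + s), the component of
    (a, b) transverse to the line is affine. *)
Lemma projective_displacement (a b c0 c1 c2 : R -> R -> R) :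
  (forall x y t s,
     t * (b (x + t) (y + s) - b x y) - s * (a (x + t) (y + s) - a x y) =
     t ^+ 2 * c0 x y + t * s * c1 x y + s ^+ 2 * c2 x y) ->
  exists2 A : 'M[R]_3, sl A &
    forall x y, a x y = proj_x A x y /\ b x y = proj_y A x y.
Proof.
move=> H.
have H0 t s := H 0 0 t s; have H1 t s := H 0 1 t (s - 1).
have H2 t s := H 1 0 (t - 1) s.
have subK1 (s : R) : 1 + (s - 1) = s by rewrite addrC subrK.
have {}H0 t s : t * (b t s - b 0 0) - s * (a t s - a 0 0) = 
  t ^+ 2 * c0 0 0 + t * s * c1 0 0 + s ^+ 2 * c2 0 0 by rewrite -H0 !add0r.
have {}H1 t s : t * (b t s - b 0 1) - (s - 1) * (a t s - a 0 1) = 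
  t ^+ 2 * c0 0 1 + t * (s - 1) * c1 0 1 + (s - 1) ^+ 2 * c2 0 1.
  by rewrite -H1 add0r subK1.
have {}H2 t s : (t - 1) * (b t s - b 1 0) - s * (a t s - a 1 0) = 
  (t - 1) ^+ 2 * c0 1 0 + (t - 1) * s * c1 1 0 + s ^+ 2 * c2 1 0.
  by rewrite -H2 add0r subK1.
(* Coefficients of a and b in 1, t, s, t^2, t s, s^2, read off from the
   differences H0 - H1 and H0 - H2, in which b resp. a cancels out. *)
set a0 := a 0 1 + c2 0 1; set a1 := b 0 1 - c1 0 1 - b 0 0.
set a2 := a 0 0 - a 0 1 - 2 * c2 0 1; set a3 := c0 0 1 - c0 0 0.
set a4 := c1 0 1 - c1 0 0; set a5 := c2 0 1 - c2 0 0.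
set b0 := b 1 0 - c0 1 0; set b1 := b 0 0 - b 1 0 + 2 * c0 1 0.
set b2 := a 1 0 - a 0 0 + c1 1 0; set b3 := c0 0 0 - c0 1 0.
set b4 := c1 0 0 - c1 1 0; set b5 := c2 0 0 - c2 1 0.
have aE t s :
    a t s = a0 + a1 * t + a2 * s + a3 * t ^+ 2 + a4 * (t * s) + a5 * s ^+ 2.
  have -> : a t s = a t s + 
   (t * (b t s - b 0 1) - (s - 1) * (a t s - a 0 1) -
   (t ^+ 2 * c0 0 1 + t * (s - 1) * c1 0 1 + (s - 1) ^+ 2 * c2 0 1)) * -1 +
   (t * (b t s - b 0 0) - s * (a t s - a 0 0) - 
    (t ^+ 2 * c0 0 0 + t * s * c1 0 0 + s ^+ 2 * c2 0 0)).
    by rewrite H0 H1; ring.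
  rewrite /a0 /a1 /a2 /a3 /a4 /a5; ring.
have bE t s :
    b t s = b0 + b1 * t + b2 * s + b3 * t ^+ 2 + b4 * (t * s) + b5 * s ^+ 2.
  have -> : b t s = b t s + 
   ((t - 1) * (b t s - b 1 0) - s * (a t s - a 1 0) -
   ((t - 1) ^+ 2 * c0 1 0 + (t - 1) * s * c1 1 0 + s ^+ 2 * c2 1 0)) -
   (t * (b t s - b 0 0) - s * (a t s - a 0 0) - 
    (t ^+ 2 * c0 0 0 + t * s * c1 0 0 + s ^+ 2 * c2 0 0)).
    by rewrite H0 H2; ring.
  rewrite /b0 /b1 /b2 /b3 /b4 /b5; ring.
have [b30 b4a3 b5a4 a50] : [/\ b3 = 0, b4 = a3, b5 = a4 & a5 = 0].
  apply: (@cubic_coefs b0 b1 b2 _ _ _ a0 a1 a2 _ _ _ (b 0 0) (a 0 0)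
    (c0 0 0) (c1 0 0) (c2 0 0)) => t s.
  rewrite -aE -bE.
  have -> : t * b t s - s * a t s =
    t * (b t s - b 0 0) - s * (a t s - a 0 0) + (t * b 0 0 - s * a 0 0) by ring.
  rewrite (H0 t s).
  ring.
(* Only the differences of the diagonal entries from the entry (0, 0), here
   a1 and b2, are prescribed; the trace condition fixes that entry. *)
pose A00 := - (a1 + b2) / 3.
exists (mx3 A00 a0 b0 (- a3) (a1 + A00) b1 (- a4) a2 (b2 + A00)).
  by rewrite /sl /= tr3E !mx3E /A00; field.
move=> x y; rewrite aE bE b30 b4a3 b5a4 a50 /proj_x /proj_y !mx3E.
by split; ring.
Qed.

End PlanarAlgebra.

Section Classification.
Context {R : realType}.
Implicit Types (v : vector_field R 2) (p q : 'rV[R]_3).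

(** The conditions [v, n1] in E and [v, n2] in F, in coordinates. *)
Lemma symmetry_eqs v : symmetries distE distF v -> 
  [/\ forall p, 'D_d_theta (fun q => v q 0 0) p = 0,
      forall p, 'D_d_theta (fun q => v q 0 1) p = 0,
      forall p, v p 0 2 = 'D_(n2 p) (fun q => v q 0 1) p
        - p 0 2 * 'D_(n2 p) (fun q => v q 0 0) p &
      forall p, 'D_(n2 p) (fun q => v q 0 2) p = 0].
Proof.
move=> [/smooth_differentiable dv vE vF].
have n1E_sec : is_section (@distE R) n1.
  by split=> [|p]; [exact: n1_smooth | exact: memv_line].
have n2F_sec : is_section (@distF R) n2.
  by split=> [|p]; [exact: n2_smooth | exact: memv_line].
have {}vE p : ('D_d_theta v p) 0 0 = 0 /\ ('D_d_theta v p) 0 1 = 0.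
  have := vE _ n1E_sec p; rewrite mem_distE /lie_bracket derive_n1 sub0r.
  by rewrite -scaleN1r !row_scaleE !mulN1r !oppr_eq0 => /andP[/eqP ? /eqP ?].
have {}vF p : v p 0 2 - ('D_(n2 p) v p) 0 1 = - p 0 2 * ('D_(n2 p) v p) 0 0 /\
    ('D_(n2 p) v p) 0 2 = 0.
  have := vF _ n2F_sec p.
  rewrite mem_distF /lie_bracket derive_n2 !row_subE !vec3E.
  by rewrite !sub0r oppr_eq0 mulrN mulNr => /andP[/eqP ? /eqP ?].
split=> p; rewrite -!derive_coord//.
- by have [] := vE p.
- by have [] := vE p.
- by have [] := vF p; lra.
- by have [] := vF p.
Qed.

Lemma symmetry_coord_differentiable v i p : symmetries distE distF v ->
  differentiable (fun q => v q 0 i) p.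
Proof.
by case=> /smooth_differentiable dv _ _; exact: coord_differentiable.
Qed.

Lemma symmetry_theta_indep v q th : symmetries distE distF v ->
  v (q + th *: d_theta) 0 0 = v q 0 0 /\ v (q + th *: d_theta) 0 1 = v q 0 1.
Proof.
move=> sv; have [v0 v1 _ _] := symmetry_eqs sv.
have indep i : (forall p, 'D_d_theta (fun q => v q 0 i) p = 0) ->
    v (q + th *: d_theta) 0 i = v q 0 i.
  move=> vi; rewrite (@affine_on_line _ _ (fun q => v q 0 i) q d_theta 0) //.
    by rewrite mulr0 addr0.
  by move=> p; exact: symmetry_coord_differentiable.
by split; exact: indep.
Qed.

Lemma symmetry_theta0 v x y th : symmetries distE distF v ->
  v (vec3 x y th) 0 0 = v (vec3 x y 0) 0 0 /\
  v (vec3 x y th) 0 1 = v (vec3 x y 0) 0 1.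
Proof.
move=> sv; have := symmetry_theta_indep (vec3 x y 0) th sv.
by rewrite d_thetaE vec3D !mulr0 !addr0 mulr1 add0r.
Qed.

(** The integral curve of [n2] through (x, y, th) is the lifted line
    (x + t, y + th t, th). Its slope rate c is constant because n2 c = 0, and
    c is the derivative of b - th a because th is constant along the curve. *)
Lemma symmetry_affine_on_lines v x y th t : symmetries distE distF v ->
  let q := vec3 (x + t) (y + th * t) 0 in let p := vec3 x y 0 in
  v q 0 1 - th * v q 0 0 = v p 0 1 - th * v p 0 0 + t * v (vec3 x y th) 0 2.
Proof.
move=> sv q p; have [_ _ vc vc0] := symmetry_eqs sv.
have dv i r : differentiable (fun q => v q 0 i) r.
  exact: symmetry_coord_differentiable.
pose w := n2 (vec3 x y th).
have lineE s : vec3 x y th + s *: w = vec3 (x + s) (y + th * s) th.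
  by rewrite /w n2E vec3D !vec3E mulr0 addr0 mulr1 [s * th]mulrC.
have n2_line s : n2 (vec3 x y th + s *: w) = w by rewrite lineE /w !n2E !vec3E.
have c_line s : v (vec3 x y th + s *: w) 0 2 = v (vec3 x y th) 0 2.
  rewrite (@affine_on_line _ _ (fun q => v q 0 2) _ _ 0) ?mulr0 ?addr0// => r.
  by have := vc0 (vec3 x y th + r *: w); rewrite n2_line.
pose f r := v r 0 1 + - (th * v r 0 0).
have df r : differentiable f r.
  by apply: differentiableB => //; exact: differentiableM.
have := @affine_on_line _ _ f (vec3 x y th) w (v (vec3 x y th) 0 2) df.
move=> /(_ _ t); rewrite lineE /f.
have [-> ->] := symmetry_theta0 (x + t) (y + th * t) th sv.
have [-> ->] := symmetry_theta0 x y th sv; apply=> s.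
rewrite -(c_line s) vc n2_line lineE vec3E.
apply: is_derive_val.
  apply: is_derive_add; first exact/derivableP/diff_derivable.
  apply: is_derive_opp; apply: is_derive_mul.
  exact/derivableP/diff_derivable.
by rewrite mulr0 addr0.
Qed.

(** Since n2 = d_x + th d_y, the slope rate n2 b - th n2 a has degree 2 in th,
    with coefficients b_x, b_y - a_x and - a_y. *)
Lemma symmetry_slope_quadratic v : symmetries distE distF v ->
  exists c0 c1 c2 : R -> R -> R, forall x y th,
    v (vec3 x y th) 0 2 = c0 x y + th * c1 x y + th ^+ 2 * c2 x y.
Proof.
move=> sv; have [_ _ vc _] := symmetry_eqs sv.
pose d i w x y : R := 'D_w (fun q => v q 0 i) (vec3 x y 0).
exists (d 1 d_x), (fun x y => d 1 d_y x y - d 0 d_x x y).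
exists (fun x y => - d 0 d_y x y) => x y th.
have dE i : (forall q, v (q + th *: d_theta) 0 i = v q 0 i) ->
    'D_(n2 (vec3 x y th)) (fun q => v q 0 i) (vec3 x y th) =
    d i d_x x y + th * d i d_y x y.
  have dv := symmetry_coord_differentiable i _ sv.
  move=> vi; rewrite /n2 /ctheta vec3E deriveE// linearD linearZ/= -!deriveE//.
  have -> : vec3 x y th = vec3 x y 0 + th *: d_theta.
    by rewrite d_thetaE vec3D !mulr0 !addr0 add0r mulr1.
  by rewrite !(@derive_translation_invariant _ _ _ _ _ (th *: d_theta)).
rewrite vc vec3E !dE => [|q|q]; try by have [] := symmetry_theta_indep q th sv.
by move: (d _ _ _ _) (d _ _ _ _) (d _ _ _ _) (d _ _ _ _) => *; ring.
Qed.

Lemma symmetry_displacement v : symmetries distE distF v ->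
  exists c0 c1 c2 : R -> R -> R, forall x y t s,
    let q := vec3 (x + t) (y + s) 0 in let p := vec3 x y 0 in
    t * (v q 0 1 - v p 0 1) - s * (v q 0 0 - v p 0 0) =
    t ^+ 2 * c0 x y + t * s * c1 x y + s ^+ 2 * c2 x y.
Proof.
move=> sv; have [c0 [c1 [c2 cE]]] := symmetry_slope_quadratic sv.
exists c0, c1, c2 => x y t s /=.
(* For t <> 0 the two points lie on a line of slope s / t. *)
have disp r : r != 0 ->
    r * (v (vec3 (x + r) (y + s) 0) 0 1 - v (vec3 x y 0) 0 1)
    - s * (v (vec3 (x + r) (y + s) 0) 0 0 - v (vec3 x y 0) 0 0)
    = r ^+ 2 * c0 x y + r * s * c1 x y + s ^+ 2 * c2 x y.
  move=> r0; have := symmetry_affine_on_lines x y (s / r) r sv.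
  rewrite /= divfK// cE.
  move: (v (vec3 (x + r) (y + s) 0) 0 1) (v (vec3 (x + r) (y + s) 0) 0 0)
    (v (vec3 x y 0) 0 1) (v (vec3 x y 0) 0 0) => b' a' b a h.
  have -> : r * (b' - b) - s * (a' - a) =
      r * ((b' - s / r * a') - (b - s / r * a)) by field.
  by rewrite h; field.
have [->|t0] := eqVneq t 0; last exact: disp.
(* Vertical displacements are limits of the others. *)
have cv i : {for 0, continuous (fun r : R => v (vec3 (x + r) (y + s) 0) 0 i)}.
  apply/differentiable_continuous/derivable1_diffP.
  rewrite (_ : (fun r => _) = (fun r => v (vec3 x (y + s) 0 + r *: d_x) 0 i)).
    have dvi := symmetry_coord_differentiable i _ sv.
    by have [] := @is_derive_line _ _ _ (vec3 x (y + s) 0) d_x 0 (dvi _).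
  by apply/funext => r; rewrite d_xE vec3D !mulr0 !addr0 mulr1.
apply/eqP; rewrite -subr_eq0; apply/eqP.
have cdisp := @displacement_continuous _ _ _ (v (vec3 x y 0) 0 1)
  (v (vec3 x y 0) 0 0) s (c0 x y) (c1 x y) (s ^+ 2 * c2 x y) 0 (cv 1) (cv 0).
by apply: (continuous_eq0 cdisp) => r r0; rewrite disp// subrr.
Qed.

Lemma symmetry_proj_field v : symmetries distE distF v ->
  exists2 A : 'M[R]_3, sl A & v = proj_field A.
Proof.
move=> sv; have [c0 [c1 [c2 disp]]] := symmetry_displacement sv.
pose a x y : R := v (vec3 x y 0) 0 0; pose b x y : R := v (vec3 x y 0) 0 1.
have [A slA abE] := @projective_displacement _ a b c0 c1 c2 disp.
exists A => //; apply/funext => p; rewrite /proj_field [in LHS](vec3_coord p).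
move: (p 0 0) (p 0 1) (p 0 2) => x y th.
have [vx vy] := abE x y; have [v0 v1] := symmetry_theta0 x y th sv.
apply: rV3P; rewrite vec3E ?v0 ?v1 -?vx -?vy//.
(* The slope rate is the increment of b - th a along a unit step in x. *)
have : b (x + 1) (y + th * 1) - th * a (x + 1) (y + th * 1) =
    b x y - th * a x y + 1 * v (vec3 x y th) 0 2.
  exact: symmetry_affine_on_lines.
rewrite mulr1 mul1r.
have [-> ->] := abE (x + 1) (y + th); have [-> ->] := abE x y.
move=> /esym/(canRL (addKr _)) ->.
by rewrite /proj_x /proj_y /proj_theta; ring.
Qed.

End Classification.

(** * Spans and linear maps *)

Section Span.
Context {R : realType}.

Lemma span_set0 (V : lmodType R) (v : V) : span_set [::] v <-> v = 0.
Proof.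
split=> [[c ->]|->]; first by rewrite big_ord0.
by exists (fun=> 0); rewrite big_ord0.
Qed.

Lemma span_set_cons (V : lmodType R) (x v : V) (s : seq V) :
  span_set (x :: s) v <-> exists (a : R) w, span_set s w /\ v = a *: x + w.
Proof.
split=> [[c ->]|[a [w [[c ->] ->]]]].
  exists (c ord0), (\sum_(i < size s) c (lift ord0 i) *: s`_i).
  by split; [exists (fun i => c (lift ord0 i))|rewrite big_ord_recl].
pose c' (i : 'I_(size s).+1) := oapp c a (unlift ord0 i); exists c'.
rewrite big_ord_recl {1}/c' unlift_none /=; congr (_ + _).
by apply: eq_bigr => i _; rewrite /c' liftK.
Qed.

Lemma span_set_nth (V : lmodType R) (s : seq V) i :
  (i < size s)%N -> span_set s s`_i.
Proof.
move=> si; exists (fun j => ((j : nat) == i)%:R).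
rewrite (bigD1 (Ordinal si))//= eqxx scale1r big1 ?addr0// => j ji.
by rewrite (negPf ji : (j : nat) == i = false) scale0r.
Qed.

Lemma subspace_span (V : lmodType R) (g : set V) (s : seq V) :
  Defs.subspace g -> (forall i, (i < size s)%N -> g s`_i) -> span_set s `<=` g.
Proof.
move=> [g0 gD]; elim: s => [|x s IHs] gs v; first by move/span_set0 => ->.
move=> /span_set_cons[a [w [sw ->]]]; apply: gD; first exact: (gs 0%N).
by apply: IHs sw => i; exact: (gs i.+1).
Qed.

Lemma span_map (V W : lmodType R) (f : {linear V -> W}) (s : seq V) :
  span_set (map f s) = f @` span_set s.
Proof.
apply/seteqP; split=> w; elim: s w => [|x s IHs] w.
- by move=> /span_set0 ->; exists 0; [exact/span_set0|rewrite linear0].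
- move=> /span_set_cons[a [_ [/IHs[v sv <-] ->]]].
  exists (a *: x + v); last exact: linearP.
  by apply/span_set_cons; exists a, v.
- by move=> [_ /span_set0 -> <-]; rewrite linear0; exact/span_set0.
- move=> [_ /span_set_cons[a [v [sv ->]]] <-]; rewrite linearP.
  by apply/span_set_cons; exists a, (f v); split=> //; apply: IHs; exists v.
Qed.

Lemma subspace_image (V W : lmodType R) (f : {linear V -> W}) (g : set V) :
  Defs.subspace g -> Defs.subspace (f @` g).
Proof.
move=> [g0 gD]; split; first by exists 0; rewrite ?linear0.
move=> a _ _ [u gu <-] [v gv <-].
by exists (a *: u + v); [exact: gD|rewrite linearP].
Qed.

End Span.

(** * The Lie algebra of symmetries is sl(3) *)

HB.instance Definition _ (R : realType) := GRing.isLinear.Build R 'M[R]_3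
  (vector_field R 2) *:%R (@proj_field R) (@proj_field_linear R).

Section SpecialLinear.
Context {R : realType} {n : nat}.
Implicit Types A B C : 'M[R]_n.

Lemma sl_subspace : Defs.subspace (@sl R n).
Proof.
split=> [|a u v]; rewrite /sl /= ?mxtrace0//.
by rewrite mxtraceD mxtraceZ => -> ->; rewrite mulr0 addr0.
Qed.

Lemma sl_bracket A B : sl (mx_bracket A B).
Proof. by rewrite /sl /= /mx_bracket raddfB /= mxtrace_mulC subrr. Qed.

Lemma mx_bracket_linearl (a : R) A B C :
  mx_bracket (a *: A + B) C = a *: mx_bracket A C + mx_bracket B C.
Proof.
rewrite /mx_bracket mulmxDl mulmxDr -scalemxAl -scalemxAr.
by rewrite scalerBr opprD addrACA.
Qed.

Lemma mx_bracket_linearr (a : R) A B C :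
  mx_bracket C (a *: A + B) = a *: mx_bracket C A + mx_bracket C B.
Proof.
rewrite /mx_bracket mulmxDl mulmxDr -scalemxAl -scalemxAr.
by rewrite scalerBr opprD addrACA.
Qed.

Lemma mx_jacobi A B C : mx_bracket A (mx_bracket B C) +
  mx_bracket B (mx_bracket C A) + mx_bracket C (mx_bracket A B) = 0.
Proof.
rewrite /mx_bracket !mulmxBr !mulmxBl !mulmxA.
move: (A *m B *m C) (A *m C *m B) (B *m A *m C) (B *m C *m A) (C *m A *m B)
  (C *m B *m A) => ABC ACB BAC BCA CAB CBA.
by apply/matrixP => i j; rewrite !mxE; ring.
Qed.

End SpecialLinear.

Section FlatSymmetries.
Context {R : realType}.
Implicit Types A B : 'M[R]_3.

Lemma symmetriesE : symmetries distE distF = proj_field @` @sl R 3.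
Proof.
apply/seteqP; split=> [v /symmetry_proj_field[A slA ->]|_ [A _ <-]].
  by exists A.
exact: proj_field_symmetry.
Qed.

(** Preimages of the fields t1, ..., t8 under [proj_field], made traceless. *)
Definition t1_mx : 'M[R]_3 := mx3 0 1 0 0 0 0 0 0 0.
Definition t2_mx : 'M[R]_3 := mx3 0 0 0 0 0 1 0 0 0.
Definition t3_mx : 'M[R]_3 := mx3 0 0 1 0 0 0 0 0 0.
Definition t4_mx : 'M[R]_3 := mx3 (-1) 0 0 0 0 0 0 0 1.
Definition t5_mx : 'M[R]_3 := mx3 (1 / 3) 0 0 0 (- (2 / 3)) 0 0 0 (1 / 3).
Definition t6_mx : 'M[R]_3 := mx3 0 0 0 0 0 0 0 (1 / 2) 0.
Definition t7_mx : 'M[R]_3 := mx3 0 0 0 (-1) 0 0 0 0 0.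
Definition t8_mx : 'M[R]_3 := mx3 0 0 0 0 0 0 (- (1 / 2)) 0 0.

Ltac field_coords := by apply/funext => p; apply: rV3P;
  rewrite !vec3E /proj_x /proj_y /proj_theta
    /t1_mx /t2_mx /t3_mx /t4_mx /t5_mx /t6_mx /t7_mx /t8_mx !mx3E ?mxE /=
    ?mulr1n ?mulr0n /cx /cy /ctheta; field.

Lemma t1E : t1 = proj_field t1_mx. Proof. field_coords. Qed.
Lemma t2E : t2 = proj_field t2_mx. Proof. field_coords. Qed.
Lemma t3E : t3 = proj_field t3_mx. Proof. field_coords. Qed.
Lemma t4E : t4 = proj_field t4_mx. Proof. field_coords. Qed.
Lemma t5E : t5 = proj_field t5_mx. Proof. field_coords. Qed.
Lemma t6E : t6 = proj_field t6_mx. Proof. field_coords. Qed.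
Lemma t7E : t7 = proj_field t7_mx. Proof. field_coords. Qed.
Lemma t8E : t8 = proj_field t8_mx. Proof. field_coords. Qed.

Definition tE := (t1E, t2E, t3E, t4E, t5E, t6E, t7E, t8E).

Lemma span_sl : span_set
  [:: t1_mx; t2_mx; t3_mx; t4_mx; t5_mx; t6_mx; t7_mx; t8_mx] = @sl R 3.
Proof.
apply/seteqP; split.
  apply: subspace_span; first exact: sl_subspace.
  by move=> [|[|[|[|[|[|[|[|//]]]]]]]] _; rewrite /sl /= tr3E
    /t1_mx /t2_mx /t3_mx /t4_mx /t5_mx /t6_mx /t7_mx /t8_mx !mx3E; field.
move=> A; rewrite /sl /= tr3E => trA.
pose c5 := - 3 / 2 * A 1 1.
have -> : A = A 0 1 *: t1_mx + (A 1 2 *: t2_mx + (A 0 2 *: t3_mx +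
    ((A 2 2 + A 1 1 / 2) *: t4_mx + (c5 *: t5_mx + (2 * A 2 1 *: t6_mx +
    (- A 1 0 *: t7_mx + (- (2 * A 2 0) *: t8_mx + 0))))))).
  apply: mx3P; rewrite !mxE /c5 /=; lra.
by do 8!(apply/span_set_cons; do 2!eexists; split; last reflexivity);
    exact/span_set0.
Qed.

End FlatSymmetries.

(** * The grading by the diagonals of sl(3) *)

Section Homogeneous.
Context {R : realType}.
Implicit Types A B : 'M[R]_3.

(** The eigenspace of the bracket with [t4_mx] for the eigenvalue k: as [t4_mx]
    is diagonal with entries -1, 0, 1, the elementary matrix at (i, j) has
    eigenvalue i - j. *)
Definition homogeneous (k : int) : set 'M[R]_3 :=
  [set A | sl A /\ forall i j : 'I_3, i%:Z != j%:Z + k -> A i j = 0].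

Lemma homogeneous_subspace k : Defs.subspace (homogeneous k).
Proof.
have [s0 sD] := @sl_subspace R 3.
split=> [|a A B [slA Ak] [slB Bk]].
  by split=> // i j _; rewrite mxE.
split=> [|i j ij]; first exact: sD.
by rewrite !mxE Ak// Bk// mulr0 addr0.
Qed.

Lemma homogeneous_bracket k l A B : homogeneous k A -> homogeneous l B ->
  homogeneous (k + l) (mx_bracket A B).
Proof.
move=> [_ Ak] [_ Bl]; split=> [|i j ij]; first exact: sl_bracket.
rewrite !mxE !big1 ?subr0// => c _.
- have [ic|ic] := eqVneq i%:Z (c%:Z + l); last by rewrite Bl// mul0r.
  by rewrite (Ak c)// ?mulr0//; apply: contra ij => /eqP cj; apply/eqP; lia.
- have [ic|ic] := eqVneq i%:Z (c%:Z + k); last by rewrite Ak// mul0r.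
  by rewrite (Bl c)// ?mulr0//; apply: contra ij => /eqP cj; apply/eqP; lia.
Qed.

Lemma homogeneous_large k A : 2 < `|k| -> homogeneous k A -> A = 0.
Proof.
move=> k2 [_ Ak]; apply/matrixP => i j; rewrite mxE Ak//.
by have := ltn_ord i; have := ltn_ord j => ? ?; apply/eqP => ijk; lia.
Qed.

Definition homogeneous_part (k : int) A : 'M[R]_3 :=
  \matrix_(i, j) if i%:Z == j%:Z + k then A i j else 0.

Lemma homogeneous_partP k A : sl A -> homogeneous k (homogeneous_part k A).
Proof.
move=> slA; split=> [|i j /negPf ij]; last by rewrite mxE ij.
rewrite /sl /= /mxtrace; have [->|k0] := eqVneq k 0.
  by rewrite -[RHS]slA; apply: eq_bigr => i _; rewrite mxE addr0 eqxx.
rewrite big1// => i _; rewrite mxE; case: eqP => // ik.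
by case/eqP: k0; lia.
Qed.

(** An entry (i, j) lies on a single diagonal, so only the summand
    m = i - j + 2 contributes. *)
Lemma sum_homogeneous (B : int -> 'M[R]_3) (i j : 'I_3) :
  (forall k, homogeneous k (B k)) ->
  (\sum_(m < 5) B (m%:Z - 2)) i j = B (i%:Z - j%:Z) i j.
Proof.
move=> Bh; have m5 : (i + 2 - j < 5)%N by have := ltn_ord i; lia.
have j3 := ltn_ord j.
rewrite summxE (bigD1 (Ordinal m5))//= big1 ?addr0 => [|m mi].
  by congr (B _ _ _); lia.
apply: (Bh _).2; apply: contra mi => /eqP ij; apply/eqP/val_inj => /=; lia.
Qed.

Lemma sum_homogeneous_part A : sl A ->
  \sum_(m < 5) homogeneous_part (m%:Z - 2) A = A.
Proof.
move=> slA; apply/matrixP => i j.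
rewrite (@sum_homogeneous (fun k => homogeneous_part k A)) => [|k].
  by rewrite mxE addrC subrK eqxx.
exact: homogeneous_partP.
Qed.

Lemma homogeneous_part_sum (B : int -> 'M[R]_3) k :
  (forall l, homogeneous l (B l)) ->
  homogeneous_part k (\sum_(m < 5) B (m%:Z - 2)) = B k.
Proof.
move=> Bh; apply/matrixP => i j; rewrite mxE; case: eqP => [ij|/eqP ij].
  by rewrite sum_homogeneous//; congr (B _ _ _); lia.
by rewrite (Bh k).2.
Qed.

Definition homogeneous_basis (k : int) : seq 'M[R]_3 :=
  if k == - 2 then [:: t3_mx] else if k == - 1 then [:: t1_mx; t2_mx]
  else if k == 0 then [:: t4_mx; t5_mx] else if k == 1 then [:: t6_mx; t7_mx]
  else if k == 2 then [:: t8_mx] else [::].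

Lemma span_homogeneous_basis k : span_set (homogeneous_basis k) = homogeneous k.
Proof.
apply/seteqP; split.
  apply: subspace_span; first exact: homogeneous_subspace.
  rewrite /homogeneous_basis; case: eqP => [->|_]; last case: eqP => [->|_];
  last case: eqP => [->|_]; last case: eqP => [->|_];
  last case: eqP => [->|_];
  move=> [|[|//]] //= _; (split; first by rewrite /sl /= tr3E
      /t1_mx /t2_mx /t3_mx /t4_mx /t5_mx /t6_mx /t7_mx /t8_mx !mx3E; field);
  by do 2!apply: ord3P; rewrite ?mxE.
move=> A [slA Ak]; have := slA; rewrite /sl /= tr3E => trA.
rewrite /homogeneous_basis; case: eqP => [kE|k1]; last case: eqP => [kE|k2];
  last case: eqP => [kE|k3]; last case: eqP => [kE|k4];
  last case: eqP => [kE|k5]; rewrite ?kE in Ak.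
- have -> : A = A 0 2 *: t3_mx + 0.
    by apply: mx3P; rewrite !mxE /=; first [by rewrite [LHS]Ak//; ring | lra].
  by (apply/span_set_cons; do 2!eexists; split; last reflexivity);
    exact/span_set0.
- have -> : A = A 0 1 *: t1_mx + (A 1 2 *: t2_mx + 0).
    by apply: mx3P; rewrite !mxE /=; first [by rewrite [LHS]Ak//; ring | lra].
  by do 2!(apply/span_set_cons; do 2!eexists; split; last reflexivity);
    exact/span_set0.
- have -> : A = (A 2 2 + A 1 1 / 2) *: t4_mx + (- 3 / 2 * A 1 1 *: t5_mx + 0).
    by apply: mx3P; rewrite !mxE /=; first [by rewrite [LHS]Ak//; ring | lra].
  by do 2!(apply/span_set_cons; do 2!eexists; split; last reflexivity);
    exact/span_set0.
- have -> : A = 2 * A 2 1 *: t6_mx + (- A 1 0 *: t7_mx + 0).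
    by apply: mx3P; rewrite !mxE /=; first [by rewrite [LHS]Ak//; ring | lra].
  by do 2!(apply/span_set_cons; do 2!eexists; split; last reflexivity);
    exact/span_set0.
- have -> : A = - (2 * A 2 0) *: t8_mx + 0.
    by apply: mx3P; rewrite !mxE /=; first [by rewrite [LHS]Ak//; ring | lra].
  by (apply/span_set_cons; do 2!eexists; split; last reflexivity);
    exact/span_set0.
- by apply/span_set0/(@homogeneous_large k) => //; lia.
Qed.

Lemma flat_gradingE k : flat_grading k = proj_field @` homogeneous k.
Proof.
rewrite -span_homogeneous_basis -span_map /flat_grading !tE; congr span_set.
by rewrite /homogeneous_basis; do 5?case: ifP => _.
Qed.

End Homogeneous.

Section Conclusion.
Context {R : realType}.

Lemma flat_lie_algebra : lie_algebra (proj_field @` @sl R 3) (@lie_bracket R 2).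
Proof.
split.
- exact: subspace_image sl_subspace.
- move=> _ _ [A _ <-] [B _ <-]; rewrite proj_field_bracket.
  by exists (mx_bracket A B) => //; exact: sl_bracket.
- move=> a _ _ _ [A _ <-] [B _ <-] [C _ <-].
  by rewrite -linearP !proj_field_bracket mx_bracket_linearl
    mx_bracket_linearr !linearP.
- move=> _ [A _ <-].
  by rewrite proj_field_bracket /mx_bracket subrr linear0.
- move=> _ _ _ [A _ <-] [B _ <-] [C _ <-].
  by rewrite !proj_field_bracket -!linearD mx_jacobi linear0.
Qed.

Lemma flat_lie_isomorphic : lie_isomorphic (@sl R 3) (@mx_bracket R 3)
  (proj_field @` @sl R 3) (@lie_bracket R 2).
Proof.
exists proj_field; split=> [|a A B _ _|A B _ _].
- split.
  + by move=> A slA; exists A.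
  + by move=> A B; rewrite !inE; exact: proj_field_inj.
  + by [].
- exact: linearP.
- by rewrite proj_field_bracket.
Qed.

Lemma t3_neq0 : @t3 R <> 0.
Proof.
move=> /(congr1 (fun X : vector_field R 2 => X 0 0 1)); rewrite !mxE /= => /eqP.
by rewrite oner_eq0.
Qed.

Lemma flat_contact_grading :
  contact_grading (proj_field @` @sl R 3) (@lie_bracket R 2) flat_grading.
Proof.
split.
- split=> k; rewrite flat_gradingE.
    split; first by apply: subspace_image; exact: homogeneous_subspace.
    by move=> _ [A [slA _] <-]; exists A.
  move=> k2; apply/seteqP; split=> [_ [A Ak <-]|_ ->].
    by rewrite (homogeneous_large k2 Ak) /= linear0.
  by exists 0; [exact: (homogeneous_subspace k).1|rewrite linear0].
- move=> _ [A slA <-]; exists (fun k => proj_field (homogeneous_part k A)).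
  split.
    split=> [k|]; last by rewrite -linear_sum sum_homogeneous_part.
    rewrite flat_gradingE; exists (homogeneous_part k A) => //.
    exact: homogeneous_partP.
  move=> u [uk Au].
  have /choice[B BE] : forall k,
      exists B, homogeneous k B /\ proj_field B = u k.
    by move=> k; have := uk k; rewrite flat_gradingE => -[B Bk <-]; exists B.
  have AB : A = \sum_(m < 5) B (m%:Z - 2).
    apply: proj_field_inj => //.
      rewrite /sl /= raddf_sum big1// => m _; exact: (BE _).1.1.
    by rewrite Au linear_sum; apply: eq_bigr => m _ /=; rewrite (BE _).2.
  apply/funext => k; rewrite AB homogeneous_part_sum ?(BE k).2// => l.
  exact: (BE l).1.
- move=> k l u v; rewrite !flat_gradingE => -[A Ak <-] [B Bl <-].
  rewrite proj_field_bracket; exists (mx_bracket A B) => //.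
  exact: homogeneous_bracket.
- exists [tuple t3]; split=> // c; rewrite big_ord1 => ct3 i; rewrite [i]ord1.
  have /eqP := ct3; rewrite scaler_eq0 => /orP[/eqP//|/eqP].
  by move/t3_neq0.
(* A matrix of degree -1 has only the entries (0, 1) and (1, 2), which are
   seen, up to sign, at (0, 2) in its brackets with t2_mx and t1_mx. *)
- move=> u; rewrite flat_gradingE => -[A [slA Ak] <-] Anull.
  have brA (B : 'M[R]_3) : homogeneous (-1) B -> mx_bracket A B = 0.
    move=> Bk; apply: proj_field_inj; [exact: sl_bracket|exact: sl_subspace.1|].
    by rewrite -proj_field_bracket linear0 Anull//; exists B.
  have t1k : homogeneous (-1) (@t1_mx R).
    by rewrite -span_homogeneous_basis;
      exact: (@span_set_nth _ _ [:: t1_mx; t2_mx] 0%N).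
  have t2k : homogeneous (-1) (@t2_mx R).
    by rewrite -span_homogeneous_basis;
      exact: (@span_set_nth _ _ [:: t1_mx; t2_mx] 1%N).
  have A01 : A 0 1 = 0.
    have := congr1 (fun B : 'M[R]_3 => B 0 2) (brA _ t2k).
    by rewrite !mxE !sum_ord3 !mxE /=; lra.
  have A12 : A 1 2 = 0.
    have := congr1 (fun B : 'M[R]_3 => B 0 2) (brA _ t1k).
    by rewrite !mxE !sum_ord3 !mxE /=; lra.
  suff -> : A = 0 by rewrite linear0.
  by apply: mx3P; rewrite [RHS]mxE ?A01 ?A12// Ak.
Qed.

End Conclusion.

Theorem proposition5p2 (R : realType) :
  let g : set (vector_field R 2) := symmetries distE distF in
  [/\ lagrangian_contact (@distN R) distE distF,
      lie_algebra g (@lie_bracket R 2),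
      g = span_set [:: t1; t2; t3; t4; t5; t6; t7; t8],
      lie_isomorphic (@sl R 3) (@mx_bracket R 3) g (@lie_bracket R 2) &
      contact_grading g (@lie_bracket R 2) flat_grading].
Proof.
move=> g; rewrite /g symmetriesE; split.
- exact: flat_lagrangian_contact.
- exact: flat_lie_algebra.
- by rewrite -span_sl -span_map /= !tE.
- exact: flat_lie_isomorphic.
- exact: flat_contact_grading.
Qed.
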